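(* Let $p$ be a prime number, let $K$ be a field with embeddings into $\mathbb{R}$ and $\mathbb{Q}_p$, and let $\alpha\in K$ have property $I$. Let $p_n/q_n$ be the convergents of $\alpha$ obtained from the algorithm described in the context. Then, in $\mathbb{Q}_p$, $$\lim_{n\to\infty}\frac{p_n}{q_n}=\alpha_{\langle p\rangle}.$$
   Context: Let $p$ be a prime and $K$ a field with field embeddings $\sigma_\infty:K\to\mathbb{R}$ and $\sigma_p:K\to\mathbb{Q}_p$. For $\alpha\in K$ write $\alpha_\infty=\sigma_\infty(\alpha)$, $\alpha_{\langle p\rangle}=\sigma_p(\alpha)$. For $u=\sum_{n}c_np^n\in\mathbb{Q}_p$ with digits $c_n\in\{0,\dots,p-1\}$ ($c_n=0$ for $n<v_p(u)$), put $\lfloor u\rfloor_p=\sum_{n\le 0}c_np^n\in\mathbb{Z}[1/p]$. Property $I$: $\alpha_\infty\in(-\frac p2,\frac p2]$ and $v_p(\alpha_{\langle p\rangle})>0$. For $\alpha\in K^\times$ let $a^{(0)}(\alpha)=mp+\lfloor(1/\alpha)_{\langle p\rangle}\rfloor_p$, where $m$ is the smallest among the integers $i$ minimizing $|(1/\alpha)_\infty-ip-\lfloor(1/\alpha)_{\langle p\rangle}\rfloor_p|$; let $a^{(1)}(\alpha)=m'+\lfloor(1/\alpha)_{\langle p\rangle}\rfloor_p$, where $m'$ is the smallest among the integers $i$ minimizing $|(1/\alpha)_\infty-i-\lfloor(1/\alpha)_{\langle p\rangle}\rfloor_p|$. Put $T_{p,\epsilon}(\alpha)=\frac1\alpha-a^{(\epsilon)}(\alpha)$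 for $\epsilon\in\{0,1\}$. Algorithm: $\alpha_{(1)}=\alpha$; for $n\ge1$, if $\alpha_{(n)}\neq0$, set $\epsilon=0$ if $n$ is even, $\epsilon=1$ if $n$ is odd, $a_n(\alpha)=a^{(\epsilon)}(\alpha_{(n)})$ and $\alpha_{(n+1)}=T_{p,\epsilon}(\alpha_{(n)})$; if $\alpha_{(n)}=0$, terminate. Convergents: $p_0=0$, $q_0=1$, and for $n\ge1$ (as long as $a_n(\alpha)$ is defined) $$\begin{pmatrix} p_{n-1} & p_n \\ q_{n-1} & q_n \end{pmatrix}=\begin{pmatrix} 0 & 1 \\ 1 & a_1(\alpha) \end{pmatrix}\cdots\begin{pmatrix} 0 & 1 \\ 1 & a_n(\alpha) \end{pmatrix}.$$ One has $q_n\ne0$ for all such $n$. If the algorithm terminates, so that there are only finitely many convergents $p_0/q_0,\dots,p_N/q_N$, the limit is understood as the last convergent $p_N/q_N$. *)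

(* Defs.v *)
From HB Require Import structures.
From mathcomp Require Import all_boot all_order all_algebra.
From mathcomp Require Import mathcomp_extra boolp classical_sets functions.
From mathcomp Require Import cardinality fsbigop reals constructive_ereal.
From mathcomp Require Import zify lra.

Set Implicit Arguments.
Unset Strict Implicit.
Unset Printing Implicit Defensive.

Import Order.TTheory GRing.Theory Num.Theory.

Local Open Scope classical_set_scope.
Local Open Scope ring_scope.

(* The ring Z_p as the inverse limit of the Z/p^n: an element is the sequence
   of its residues mod p^n, each represented in [0, p^n).  The type depends on
   a proof that p is prime because Z_p is an integral domain only then. *)
Definition coherent p (x : nat -> nat) := forall n, (x n.+1 %% p ^ n = x n)%N.

Record padicint p (pr_p : prime p) := PadicInt {
  residue : nat -> nat;
  _ : `[< coherent p residue >] }.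

Section PadicIntegers.
Variables (p : nat) (pr_p : prime p).
Local Notation padicint := (padicint pr_p).

HB.instance Definition _ := [isSub for @residue p pr_p].
HB.instance Definition _ := [Choice of padicint by <:].

Let pX_gt0 n : (0 < p ^ n)%N. Proof. by rewrite expn_gt0 prime_gt0. Qed.

Lemma residueS (x : padicint) n : (residue x n.+1 %% p ^ n = residue x n)%N.
Proof. by case: x => x /= /asboolP. Qed.

Lemma residue_lt (x : padicint) n : (residue x n < p ^ n)%N.
Proof. by rewrite -residueS ltn_mod. Qed.

Lemma residue_mod (x : padicint) m n :
  (m <= n)%N -> (residue x n %% p ^ m = residue x m)%N.
Proof.
move=> /subnKC <-; elim: (n - m)%N => [|k IH].
  by rewrite addn0 modn_small ?residue_lt.
rewrite -IH -(residueS x (m + k)) addnS modn_dvdm //.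
by rewrite dvdn_exp2l ?leq_addr.
Qed.

Lemma padicintP (x y : padicint) : (forall n, residue x n = residue y n) -> x = y.
Proof. by move=> xy; apply: val_inj; apply: funext. Qed.

Lemma coherent_mod (f : nat -> nat) :
  (forall n, (f n.+1 = f n %[mod p ^ n])%N) ->
  `[< coherent p (fun n => f n %% p ^ n)%N >].
Proof.
by move=> ff; apply/asboolP => n; rewrite modn_dvdm ?ff // dvdn_exp2l.
Qed.

Definition mk_padicint f (ff : forall n, (f n.+1 = f n %[mod p ^ n])%N) :=
  @PadicInt p pr_p (fun n => f n %% p ^ n)%N (coherent_mod ff).

Let pint_nat_subproof (k : nat) n : (k = k %[mod p ^ n])%N. Proof. by []. Qed.
Definition padicint_nat k := mk_padicint (pint_nat_subproof k).

Let add_subproof (x y : padicint) n :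
  (residue x n.+1 + residue y n.+1 = residue x n + residue y n %[mod p ^ n])%N.
Proof. by rewrite -modnDm !residueS. Qed.
Definition padicint_add x y := mk_padicint (add_subproof x y).

Let mul_subproof (x y : padicint) n :
  (residue x n.+1 * residue y n.+1 = residue x n * residue y n %[mod p ^ n])%N.
Proof. by rewrite -modnMm !residueS. Qed.
Definition padicint_mul x y := mk_padicint (mul_subproof x y).

Let opp_subproof (x : padicint) n :
  (p ^ n.+1 - residue x n.+1 = p ^ n - residue x n %[mod p ^ n])%N.
Proof.
apply/eqP; rewrite -(eqn_modDr (residue x n.+1)) subnK; last first.
  exact/ltnW/residue_lt.
rewrite -modnDmr residueS subnK; last exact/ltnW/residue_lt.
by rewrite modnn -/(_ %| _)%N dvdn_exp2l.
Qed.
Definition padicint_opp x := mk_padicint (opp_subproof x).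

Let addA : associative padicint_add.
Proof. by move=> x y z; apply: padicintP => n /=; rewrite modnDml modnDmr addnA. Qed.
Let addC : commutative padicint_add.
Proof. by move=> x y; apply: padicintP => n /=; rewrite addnC. Qed.
Let add0 : left_id (padicint_nat 0) padicint_add.
Proof.
move=> x; apply: padicintP => n /=.
by rewrite mod0n add0n modn_small ?residue_lt.
Qed.
Let addN : left_inverse (padicint_nat 0) padicint_opp padicint_add.
Proof.
move=> x; apply: padicintP => n /=; rewrite modnDml subnK ?modnn ?mod0n //.
exact/ltnW/residue_lt.
Qed.
HB.instance Definition _ := GRing.isZmodule.Build padicint addA addC add0 addN.

Let mulA : associative padicint_mul.
Proof. by move=> x y z; apply: padicintP => n /=; rewrite modnMml modnMmr mulnA. Qed.
Let mulC : commutative padicint_mul.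
Proof. by move=> x y; apply: padicintP => n /=; rewrite mulnC. Qed.
Let mul1 : left_id (padicint_nat 1) padicint_mul.
Proof.
move=> x; apply: padicintP => n /=.
by rewrite modnMml mul1n modn_small ?residue_lt.
Qed.
Let mulDl : left_distributive padicint_mul padicint_add.
Proof.
by move=> x y z; apply: padicintP => n /=; rewrite modnMml modnDm mulnDl.
Qed.
Let nz1 : padicint_nat 1 != 0.
Proof.
apply/eqP => /(congr1 (fun x => residue x 1)) /=.
by rewrite expn1 mod0n modn_small ?prime_gt1.
Qed.
HB.instance Definition _ :=
  GRing.Zmodule_isComNzRing.Build padicint mulA mulC mul1 mulDl nz1.

Definition padicint_unit : pred padicint := fun x => `[< exists y, y * x = 1 >].
Definition padicint_inv (x : padicint) : padicint :=
  if padicint_unit x then xget 0 [set y | y * x = 1] else x.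

Let mulVx : {in padicint_unit, left_inverse 1 padicint_inv *%R}.
Proof.
move=> x xu; have ux : padicint_unit x by [].
rewrite /padicint_inv ux.
by move/asboolP : ux => /xgetPex-/(_ 0).
Qed.
Let unitPl (x y : padicint) : y * x = 1 -> padicint_unit x.
Proof. by move=> yx; apply/asboolP; exists y. Qed.
Let inv_out : {in [predC padicint_unit], padicint_inv =1 id}.
Proof.
move=> x xu; have /negbTE ux : ~~ padicint_unit x by [].
by rewrite /padicint_inv ux.
Qed.
HB.instance Definition _ :=
  GRing.ComNzRing_hasMulInverse.Build padicint mulVx unitPl inv_out.

Lemma residue0 n : residue 0 n = 0%N. Proof. exact: mod0n. Qed.

Lemma padicint_neq0 (x : padicint) : x != 0 -> exists n, residue x n != 0%N.
Proof.
apply: contra_neqP => /forallNP x0; apply: padicintP => n.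
by rewrite residue0; have /negP := x0 n; rewrite negbK => /eqP.
Qed.

Let integral (x y : padicint) : x * y = 0 -> (x == 0) || (y == 0).
Proof.
move=> xy0; apply: contraT; rewrite negb_or => /andP[].
move=> /padicint_neq0[n xn] /padicint_neq0[m ym].
move/(congr1 (fun x => residue x (n + m)%N)) : xy0 => /=.
have small (z : padicint) k l : residue z k != 0%N -> (k <= l)%N ->
    (0 < residue z l)%N /\ (logn p (residue z l) < k)%N.
  move=> zk kl; have zl : ~~ (p ^ k %| residue z l)%N.
    by rewrite /dvdn residue_mod.
  have zl0 : (0 < residue z l)%N.
    by rewrite lt0n; apply: contraNN zl => /eqP ->; rewrite dvdn0.
  by split=> //; move: zl; rewrite pfactor_dvdn // -ltnNge.
have [xp lx] := small x n (n + m)%N xn (leq_addr _ _).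
have [yp ly] := small y m (n + m)%N ym (leq_addl _ _).
rewrite mod0n => /eqP; apply: contraLR => _.
rewrite -/(dvdn _ _) pfactor_dvdn ?muln_gt0 ?xp ?yp // lognM // -ltnNge.
by rewrite -addnS leq_add // ltnW.
Qed.
HB.instance Definition _ := GRing.ComUnitRing_isIntegral.Build padicint integral.

End PadicIntegers.

Notation padic pr_p := {fraction (padicint pr_p)}.

Section Padic.
Variables (p : nat) (pr_p : prime p).
Local Notation padicint := (padicint pr_p).
Local Notation padic := (padic pr_p).
Local Notation "x %:F" := (@FracField.tofrac padicint x).

Let pX_gt0 n : (0 < p ^ n)%N. Proof. by rewrite expn_gt0 prime_gt0. Qed.

Lemma residueM (x y : padicint) n :
  residue (x * y) n = (residue x n * residue y n %% p ^ n)%N.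
Proof. by []. Qed.

Lemma residueD (x y : padicint) n :
  residue (x + y) n = ((residue x n + residue y n) %% p ^ n)%N.
Proof. by []. Qed.

Lemma residue_nat k n : residue (k%:R : padicint) n = (k %% p ^ n)%N.
Proof.
elim: k => [|k IH]; first by rewrite residue0 mod0n.
by rewrite -natr1 residueD IH /= modnDm addn1.
Qed.

Lemma residue_eq0P (x : padicint) n :
  residue x n = 0%N <-> exists y : padicint, x = p%:R ^+ n * y.
Proof.
split=> [xn0|[y ->]]; last first.
  by rewrite residueM -natrX residue_nat modnn mul0n mod0n.
have div m : (p ^ n %| residue x (n + m))%N.
  by rewrite /dvdn residue_mod ?leq_addr // xn0.
have ff m : (residue x (n + m.+1) %/ p ^ n =
             residue x (n + m) %/ p ^ n %[mod p ^ m])%N.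
  apply/eqP; rewrite -(eqn_pmul2r (pX_gt0 n)) !muln_modl.
  rewrite !divnK // -expnD (addnC m n) addnS residueS modn_small //.
  by rewrite residue_lt.
exists (mk_padicint pr_p ff); apply: padicintP => m.
rewrite residueM -natrX residue_nat /= modnMml modnMmr mulnC divnK //.
by rewrite residue_mod // leq_addl.
Qed.

Lemma padicint_unitP (x : padicint) :
  reflect (residue x 1 <> 0%N) (x \is a GRing.unit).
Proof.
apply: (iffP idP) => [/unitrP[y [yx _]] x0|x1].
  have := congr1 (fun z : padicint => residue z 1) yx.
  rewrite residueM x0 muln0 mod0n -[1]/(1%:R) residue_nat expn1.
  by rewrite modn_small ?prime_gt1.
have cop n : coprime (residue x n) (p ^ n).
  case: n => [|n]; first by rewrite coprimen1.
  rewrite coprimeXr // coprime_sym prime_coprime // /dvdn -[X in (_ %% X)%N]expn1.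
  by rewrite residue_mod //; apply/eqP.
pose g n := (egcdn (residue x n) (p ^ n)).1.
have gP n : (g n * residue x n = 1 %[mod p ^ n])%N.
  have [|xn0] := posnP (residue x n).
    move=> xn0; have := cop n; rewrite xn0 /coprime gcd0n => /eqP ->.
    by rewrite !modn1.
  rewrite /g; case: egcdnP => //= u v -> _.
  by rewrite (eqP (cop n)) modnMDl.
have ff n : (g n.+1 = g n %[mod p ^ n])%N.
  have h : (g n.+1 * residue x n = 1 %[mod p ^ n])%N.
    rewrite -(residueS x n) modnMmr -(@modn_dvdm (p ^ n.+1)) ?dvdn_exp2l //.
    by rewrite gP modn_dvdm // dvdn_exp2l.
  move: (g n.+1) (g n) (gP n) h => a b hb ha.
  rewrite -[in LHS](muln1 a) -modnMmr -hb modnMmr mulnCA.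
  by rewrite -modnMmr ha modnMmr muln1.
apply/unitrPr; exists (mk_padicint pr_p ff); apply: padicintP => n.
by rewrite mulrC residueM /= modnMml gP.
Qed.

Lemma padicint_neq0_unit (x : padicint) : x != 0 ->
  exists n (w : padicint), w \is a GRing.unit /\ x = p%:R ^+ n * w.
Proof.
move=> /padicint_neq0 ex; case: (ex_minnP ex) => -[|n].
  by move=> /negP[]; have := residue_lt x 0; rewrite expn0; case: residue.
move=> xn minn; have /residue_eq0P[w xw] : residue x n = 0%N.
  by apply/eqP; apply: contraT => /minn; rewrite ltnn.
exists n, w; split=> //; apply/padicint_unitP => /residue_eq0P[y wy].
move/eqP: xn; apply; apply/residue_eq0P; exists y.
by rewrite xw wy expr1 mulrA exprSr.
Qed.

Lemma p_neq0 : (p%:R : padicint) != 0.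
Proof.
apply/eqP => /(congr1 (fun x : padicint => residue x 2)).
rewrite residue_nat residue0 modn_small; last by rewrite ltn_Pmull ?prime_gt1 ?prime_gt0.
by move=> p0; move: pr_p; rewrite p0.
Qed.

Lemma p_padic_neq0 : (p%:R : padic) != 0.
Proof. by rewrite -(rmorph_nat (@FracField.tofrac padicint)) tofrac_eq0 p_neq0. Qed.

Lemma padic_frac (u : padic) : exists x y : padicint, y != 0 /\ u = x%:F / y%:F.
Proof.
elim/quotW: u => r; exists r.1, r.2; split; first exact: denom_ratioP.
have dF : (r.2)%:F != 0 by rewrite tofrac_eq0 denom_ratioP.
apply: (mulIf dF); rewrite divfK //; unlock FracField.tofrac.
rewrite -[LHS]FracField.pi_mul; apply/eqmodP; rewrite /= FracField.equivfE.
by rewrite /FracField.mulf !numden_Ratio ?mulf_neq0 ?oner_eq0 ?denom_ratioP // !mulr1 mulrC.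
Qed.

Definition padic_order (u : padic) (k : int) :=
  exists2 w : padicint, w \is a GRing.unit & u = p%:R ^ k * w%:F.

Lemma padic_order_ex (u : padic) : u != 0 -> exists k, padic_order u k.
Proof.
have [x [y [y0 ->]]] := padic_frac u => xy0.
have : x != 0 by apply: contra_neq xy0 => ->; rewrite rmorph0 mul0r.
move=> /padicint_neq0_unit[n [w [uw ->]]].
have [m [w' [uw' ->]]] := padicint_neq0_unit y0.
exists (n%:Z - m%:Z), (w * w'^-1); first by rewrite unitrM uw unitrV.
rewrite !rmorphM !rmorphXn /= !rmorph_nat expfzDr ?p_padic_neq0 //.
rewrite -exprnP -exprnN invfM -!mulrA; congr (_ * _).
rewrite mulrCA; congr (_ * (_ * _)).
have w'0 : w'%:F != 0.
  by rewrite tofrac_eq0; apply: contraTneq uw' => ->; rewrite unitr0.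
by apply: (mulfI w'0); rewrite divff // -rmorphM divrr // rmorph1.
Qed.

Lemma padic_order_le (u : padic) (k j : int) (w : padicint) :
  padic_order u k -> u = p%:R ^ j * w%:F -> j <= k.
Proof.
move=> [v uv ->] e; rewrite leNgt; apply/negP => kj.
move/padicint_unitP: uv; apply; apply/residue_eq0P.
have {}kj : 0 < j - k by rewrite subr_gt0.
case E: (j - k) kj => [[|d]|d] // _.
exists (p%:R ^+ d * w); apply/eqP; rewrite -tofrac_eq; apply/eqP.
have pk0 : (p%:R : padic) ^ k != 0 by rewrite expfz_neq0 ?p_padic_neq0.
apply: (mulfI pk0); rewrite e mulrA expr1 -exprS !rmorphM rmorphXn rmorph_nat mulrA.
by congr (_ * _); rewrite exprnP -expfzDr ?p_padic_neq0 // -E addrC subrK.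
Qed.

Lemma padic_order_uniq (u : padic) (k j : int) :
  padic_order u k -> padic_order u j -> k = j.
Proof.
move=> uk uj; case: (uk) (uj) => [w _ ew] [v _ ev].
by apply/le_anti; rewrite (padic_order_le uj ew) (padic_order_le uk ev).
Qed.

Definition padic_val (u : padic) : \bar int :=
  if u == 0 then +oo%E else (xget 0 (padic_order u))%:E.

Lemma padic_valE (u : padic) k : padic_order u k -> padic_val u = k%:E.
Proof.
move=> uk; rewrite /padic_val; have [u0|_] := eqVneq u 0.
  case: uk => w uw; rewrite u0 => /esym/eqP; rewrite mulf_eq0 tofrac_eq0.
  rewrite expfz_eq0 (negbTE p_padic_neq0) andbF /= => /eqP w0.
  by rewrite w0 unitr0 in uw.
by rewrite (xget_unique _ uk) // => j uj; exact: padic_order_uniq uj uk.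
Qed.

Lemma le_padic_val (N : int) (u : padic) :
  (N%:E <= padic_val u)%E <-> exists w : padicint, u = p%:R ^ N * w%:F.
Proof.
have [->|u0] := eqVneq u 0.
  rewrite /padic_val eqxx leey; split=> // _.
  by exists 0; rewrite rmorph0 mulr0.
have [k uk] := padic_order_ex u0; rewrite (padic_valE uk) lee_fin.
split=> [Nk|[w e]]; last exact: padic_order_le uk e.
case: uk => w _ ->; move: Nk; rewrite -subr_ge0; case E: (k - N) => [d|] // _.
exists (p%:R ^+ d * w); rewrite rmorphM rmorphXn rmorph_nat mulrA; congr (_ * _).
by rewrite exprnP -expfzDr ?p_padic_neq0 // -E addrC subrK.
Qed.

Definition padic_cvg (s : nat -> padic) (l : padic) :=
  forall N : int, exists n0 : nat, forall n, (n0 <= n)%N ->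
    (N%:E <= padic_val (s n - l)%R)%E.

Lemma padic_val_add (N : int) (u v : padic) :
  (N%:E <= padic_val u)%E -> (N%:E <= padic_val v)%E ->
  (N%:E <= padic_val (u + v)%R)%E.
Proof.
move=> /le_padic_val[x ->] /le_padic_val[y ->]; apply/le_padic_val.
by exists (x + y); rewrite rmorphD mulrDr.
Qed.

Lemma padic_val_opp (N : int) (u : padic) :
  (N%:E <= padic_val u)%E -> (N%:E <= padic_val (- u)%R)%E.
Proof.
by move=> /le_padic_val[x ->]; apply/le_padic_val; exists (- x); rewrite rmorphN mulrN.
Qed.

(* [c] is the digit expansion of [u]: the digits vanish below [padic_val u]
   and the partial sums over all [n <= N] (finite sums, by the former clause)
   converge to [u]. *)
Definition padic_expansion (u : padic) (c : int -> nat) :=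
  [/\ forall n, (c n < p)%N,
      forall n : int, (n%:E < padic_val u)%E -> c n = 0%N &
      padic_cvg (fun N : nat =>
        \sum_(n \in [set n : int | n <= N%:Z]) ((c n)%:R * p%:R ^ n : padic)) u].

Lemma fsum_below (V : nmodType) (k N : int) (m : nat) (f : int -> V) :
  (forall n, n < k -> f n = 0) -> k + m%:Z = N + 1 ->
  \sum_(n \in [set n : int | n <= N]) f n = \sum_(i < m) f (k + i%:Z).
Proof.
move=> f0 kmN; rewrite (@fsbigE _ _ _ _ _ [seq k + i%:Z | i <- iota 0 m]).
- rewrite big_mkcond big_map -(big_mkord xpredT (fun i => f (k + i%:Z))).
  rewrite big_seq [RHS]big_seq /index_iota subn0; apply: eq_bigr => i.
  rewrite mem_iota add0n => /= im; rewrite mem_set //=.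
  by rewrite -ltzD1 -kmN ltrD2l ltz_nat.
- by rewrite map_inj_uniq ?iota_uniq // => i j /addrI[].
- move=> n /= /mapP[i]; rewrite mem_iota add0n => /= im ->.
  by rewrite -ltzD1 -kmN ltrD2l ltz_nat.
- move=> n /= nN nr; apply: f0; rewrite ltNge; apply: contra nr => kn.
  apply/mapP; exists `|n - k|%N; last by rewrite gez0_abs ?subr_ge0 //= [RHS]addrC subrK.
  rewrite mem_iota add0n /= -ltz_nat gez0_abs ?subr_ge0 //.
  by rewrite ltrBlDl kmN ltzD1.
Qed.

Definition digit_sum (d : nat -> nat) m := (\sum_(i < m) d i * p ^ i)%N.

Lemma digit_sumS d m : digit_sum d m.+1 = (digit_sum d m + d m * p ^ m)%N.
Proof. exact: big_ord_recr. Qed.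

Lemma digit_sum_lt d m : (forall i, (d i < p)%N) -> (digit_sum d m < p ^ m)%N.
Proof.
move=> dp; elim: m => [|m IH]; first by rewrite /digit_sum big_ord0 expn0.
rewrite digit_sumS expnS.
apply: (@leq_trans (p ^ m + d m * p ^ m)); first by rewrite ltn_add2r.
by rewrite -mulSn leq_mul2r dp orbT.
Qed.

Lemma digit_sum_mod d m i : (forall i, (d i < p)%N) -> (i <= m)%N ->
  (digit_sum d m %% p ^ i = digit_sum d i)%N.
Proof.
move=> dp /subnKC <-; elim: (m - i)%N => [|j IH].
  by rewrite addn0 modn_small // digit_sum_lt.
rewrite addnS digit_sumS.
by rewrite expnD -modnDmr mulnCA modnMr addn0 IH.
Qed.

Lemma partial_sum_digit_sum (k : int) (c : int -> nat) (m : nat) :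
  \sum_(i < m) ((c (k + i%:Z))%:R * p%:R ^ (k + i%:Z) : padic) =
  p%:R ^ k * (digit_sum (fun i => c (k + i%:Z)) m)%:R.
Proof.
rewrite /digit_sum natr_sum mulr_sumr; apply: eq_bigr => i _.
by rewrite expfzDr ?p_padic_neq0 // natrM natrX mulrCA exprnP.
Qed.

Lemma padic_expansion_residue (u : padic) (k : int) (w : padicint) c :
  w \is a GRing.unit -> u = p%:R ^ k * w%:F -> padic_expansion u c ->
  forall i, residue w i = digit_sum (fun i => c (k + i%:Z)) i.
Proof.
move=> uw uE [cp c0 cu] i; pose d i := c (k + i%:Z).
have vu : padic_val u = k%:E by apply: padic_valE; exists w.
have [n0 /(_ (n0 + `|k| + i)%N)] := cu (k + i%:Z); set n := (n0 + _ + _)%N.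
have [m mE] : exists m : nat, k + m%:Z = n%:Z + 1.
  by exists (absz (n%:Z + 1 - k)%R); lia.
have im : (i <= m)%N by lia.
rewrite (@fsum_below _ k _ m) //; last first.
  by move=> j jk; rewrite c0 ?mul0r // vu lte_fin.
rewrite partial_sum_digit_sum -/d {1}/n -addnA leq_addr => /(_ isT).
move=> /le_padic_val[y]; rewrite uE -mulrBr expfzDr ?p_padic_neq0 // -mulrA.
have pk0 : (p%:R : padic) ^ k != 0 by rewrite expfz_neq0 ?p_padic_neq0.
move=> /(mulfI pk0); rewrite -exprnP -(rmorph_nat (@FracField.tofrac padicint)).
rewrite -(rmorph_nat (@FracField.tofrac padicint)) -rmorphXn -rmorphB -rmorphM.
move=> /eqP; rewrite tofrac_eq subr_eq => /eqP.
move=> /(congr1 (fun x : padicint => residue x i)).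
rewrite residue_nat residueD digit_sum_mod //; last by move=> j; exact: cp.
have /residue_eq0P -> : exists z : padicint, p%:R ^+ i * y = p%:R ^+ i * z by exists y.
by rewrite add0n modn_small ?residue_lt // => <-.
Qed.

Lemma padic_expansion_ex (u : padic) : exists c, padic_expansion u c.
Proof.
have [->|u0] := eqVneq u 0.
  exists (fun=> 0%N); split=> [_|//|]; first exact: prime_gt0.
  move=> N; exists 0%N => n _; rewrite fsbig1 => [|i _]; last by rewrite mul0r.
  by rewrite subrr /padic_val eqxx leey.
have [k uk] := padic_order_ex u0; have vu := padic_valE uk.
case: uk => w uw uE; pose d i := (residue w i.+1 %/ p ^ i)%N.
have dp i : (d i < p)%N by rewrite /d ltn_divLR // -expnS residue_lt.
have dw m : digit_sum d m = residue w m.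
  elim: m => [|m IH].
    by have := residue_lt w 0; rewrite /digit_sum big_ord0 expn0; case: residue.
  rewrite digit_sumS IH -(residueS w m).
  by rewrite addnC -divn_eq.
pose c (n : int) := if n < k then 0%N else d `|n - k|%N.
have cd i : c (k + i%:Z) = d i by rewrite /c; by case: ifP => [|_]; [lia|congr d; lia].
exists c; split=> [n|n|].
- by rewrite /c; case: ifP => // _; exact: prime_gt0.
- by rewrite vu lte_fin /c => ->.
move=> M; exists (`|M| + `|k|)%N => n nM.
have Mn : M <= n%:Z + 1 by lia.
have [m mE] : exists m : nat, k + m%:Z = n%:Z + 1.
  by exists (absz (n%:Z + 1 - k)%R); lia.
rewrite (@fsum_below _ k _ m) //; last by move=> j jk; rewrite /c jk mul0r.
rewrite partial_sum_digit_sum (_ : digit_sum _ m = residue w m); last first.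
  by rewrite -dw; apply: eq_bigr => i _; rewrite cd.
apply: (@le_trans _ _ (n%:Z + 1)%:E); first by rewrite lee_fin.
apply/le_padic_val; have : residue ((residue w m)%:R - w) m = 0%N.
  have := residueD ((residue w m)%:R - w) w m; rewrite subrK residue_nat.
  move/eqP; rewrite -[X in (X %% _ == _)%N]add0n eqn_modDr mod0n.
  by rewrite modn_small ?residue_lt // => /eqP.
move=> /residue_eq0P[y wy]; exists y.
rewrite -mE expfzDr ?p_padic_neq0 // -mulrA -exprnP -(rmorph_nat (@FracField.tofrac padicint)).
by rewrite -rmorphXn -rmorphM -wy rmorphB mulrBr !rmorph_nat uE.
Qed.

Lemma padic_expansion_uniq (u : padic) c c' :
  padic_expansion u c -> padic_expansion u c' -> c = c'.
Proof.
move=> uc uc'; have [cp c0 _] := uc; have [c'p c'0 _] := uc'.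
apply: funext => n; have [u0|u0] := eqVneq u 0.
  by rewrite c0 ?c'0 // u0 /padic_val eqxx ltry.
have [k uk] := padic_order_ex u0; have vu := padic_valE uk.
case: uk => w uw uE; have [nk|kn] := ltP n k.
  by rewrite c0 ?c'0 // vu lte_fin.
have ww := padic_expansion_residue uw uE uc.
have ww' := padic_expansion_residue uw uE uc'.
have [i ->] : exists i : nat, n = k + i%:Z by exists (absz (n - k)%R); lia.
have := ww i.+1; rewrite ww' !digit_sumS -ww -ww' => /addnI /eqP.
by rewrite eqn_pmul2r // => /eqP.
Qed.

Definition padic_digits (u : padic) : int -> nat :=
  xget (fun=> 0%N) (padic_expansion u).

Lemma padic_digitsP (u : padic) : padic_expansion u (padic_digits u).
Proof. exact: xgetPex (padic_expansion_ex u). Qed.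

Definition padic_floor (u : padic) : rat :=
  \sum_(n \in [set n : int | n <= 0]) ((padic_digits u n)%:R * p%:R ^ n : rat).

End Padic.

Definition minimizer (R : realType) (f : int -> R) (i : int) :=
  forall j, f i <= f j.

Definition least_minimizer (R : realType) (f : int -> R) : int :=
  xget 0 [set i | minimizer f i /\ forall j, minimizer f j -> i <= j].

Lemma least_minimizerP (R : realType) (x d c : R) : 0 < d ->
  let f i := `|x - i%:~R * d - c| in
  minimizer f (least_minimizer f) /\
  (forall j, minimizer f j -> least_minimizer f <= j).
Proof.
move=> d0 f; pose y := (x - c) / d.
have fE i : f i = d * `|y - i%:~R|.
  rewrite -[d in RHS]gtr0_norm // -normrM /f; congr `|_|.
  by rewrite mulrBr /y mulrCA divff ?gt_eqF // mulr1 (mulrC d) addrAC.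
pose i0 := Num.ceil (y - 2^-1).
have iy : y - 2^-1 <= i0%:~R := ceil_ge _.
have yi : i0%:~R < y + 2^-1.
  have := ceilB1_lt (y - 2^-1); rewrite -/i0 intrB; lra.
have less j : j < i0 -> f i0 < f j.
  rewrite -lezD1 -(ler_int R) intrD => ji; rewrite !fE ltr_pM2l //.
  rewrite [ltRHS]ger0_norm; last by lra.
  by rewrite ltr_norml; apply/andP; split; lra.
apply: (@xgetPex _ 0 [set i | minimizer f i /\ forall j, minimizer f j -> i <= j]).
exists i0; split=> j; last first.
  by move=> /(_ i0); rewrite !leNgt; apply: contra => /less.
have [/less/ltW//|] := ltP j i0; rewrite le_eqVlt => /predU1P[->//|].
rewrite -lezD1 -(ler_int R) intrD => ij; rewrite !fE ler_pM2l //.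
rewrite [leRHS]ler0_norm; last by lra.
by rewrite ler_norml; apply/andP; split; lra.
Qed.

Section Algorithm.
Variables (p : nat) (pr_p : prime p) (R : realType) (K : fieldType).
Variables (sigma_inf : {rmorphism K -> R}) (sigma_p : {rmorphism K -> padic pr_p}).

Definition property_I (alpha : K) :=
  (- (p%:R / 2) < sigma_inf alpha <= p%:R / 2) /\
  (0%:E < padic_val (sigma_p alpha))%E.

(* a^(0) for [eps = false] and a^(1) for [eps = true]; the value lies in Z[1/p],
   a subring of rat. *)
Definition digit_coef (eps : bool) (alpha : K) : rat :=
  let d := if eps then 1%N else p in
  let f := padic_floor (sigma_p alpha^-1) in
  let m := least_minimizer
    (fun i => `|sigma_inf alpha^-1 - i%:~R * d%:R - ratr f|) in
  m%:~R * d%:R + f.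

Definition gauss_map (eps : bool) (alpha : K) : K :=
  alpha^-1 - ratr (digit_coef eps alpha).

(* [complete_quotient alpha n] is alpha_(n) for n >= 1, and [None] once the
   algorithm has terminated; the index 0 is not used. *)
Fixpoint complete_quotient (alpha : K) (n : nat) : option K :=
  match n with
  | 0 => None
  | 1 => Some alpha
  | m.+1 =>
    if complete_quotient alpha m is Some beta then
      if beta == 0 then None else Some (gauss_map (odd m) beta)
    else None
  end.

Definition partial_quotient (alpha : K) (n : nat) : option rat :=
  if complete_quotient alpha n is Some beta then
    if beta == 0 then None else Some (digit_coef (odd n) beta)
  else None.

(* The columns of this matrix are (p_{n-1}, q_{n-1}) and (p_n, q_n); it is only
   meaningful if a_1, ..., a_n are defined, see [convergent]. *)
Definition convergent_mx (alpha : K) (n : nat) : 'M[rat]_2 :=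
  \prod_(1 <= k < n.+1)
    \matrix_(i, j) if i == 0 then (if j == 0 then 0 else 1)
                   else (if j == 0 then 1 else odflt 0 (partial_quotient alpha k)).

Definition convergent_num alpha n : rat := convergent_mx alpha n 0 1.
Definition convergent_den alpha n : rat := convergent_mx alpha n 1 1.

Definition convergent (alpha : K) (n : nat) : option rat :=
  if all (fun k => partial_quotient alpha k != None) (iota 1 n)
  then Some (convergent_num alpha n / convergent_den alpha n) else None.

End Algorithm.

(* The limit in Q_p of a finite or infinite sequence of rationals ([None] past
   its end), with the convention that a finite sequence tends to its last term. *)
Definition padic_limit p (pr_p : prime p) (c : nat -> option rat) (l : padic pr_p) :=
  (exists2 r : nat -> rat, (forall n, c n = Some (r n)) &
     padic_cvg (fun n => ratr (r n)) l) \/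
  (exists N r, [/\ c N = Some r, c N.+1 = None & ratr r = l]).

(* Main.v *)
From HB Require Import structures.
Require Import Defs.
From mathcomp Require Import all_boot all_order all_algebra reals.
From mathcomp Require Import boolp classical_sets constructive_ereal zify ring.

(** Only the p-adic valuation v matters: the choice of the integer multiples m,
    m' plays no role. For odd n one has v(alpha_(n)) >= 1, for even n only
    v(alpha_(n)) >= 0, and v(a_n) = - v(alpha_(n)), so v(a_n) + v(a_(n+1)) < 0.
    In q_(n+1) = a_(n+1) q_n + q_(n-1) the first term therefore dominates, so
    v(q_n) = v(a_1) + ... + v(a_n) <= - n / 2. Finally
    p_n / q_n - alpha = +- alpha_(n+1) / (q_n (q_n + alpha_(n+1) q_(n-1)))
    has valuation at least - 2 v(q_n) >= n. *)

Set Implicit Arguments.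
Unset Strict Implicit.
Unset Printing Implicit Defensive.

Import Order.TTheory GRing.Theory Num.Theory.

Local Open Scope classical_set_scope.
Local Open Scope ring_scope.

(** * The embedding of the rationals into a field of characteristic zero *)

Section RationalEmbedding.
Variables (F : fieldType) (charF : [pchar F] =i pred0).

Lemma pchar0_intr_eq0 (z : int) : (z%:~R == 0 :> F) = (z == 0).
Proof.
by case: z => n; rewrite ?NegzE ?mulrNz ?oppr_eq0 -pmulrn (pcharf0P F).1.
Qed.

(** [ratr] reads off the reduced fraction, while sums and products of fractions come out unreduced;
    cross-multiplication shows that the value is the same. *)
Lemma pchar0_ratr_frac (n d : int) : d != 0 ->
  ratr (n%:~R / d%:~R) = n%:~R / d%:~R :> F.
Proof.
move=> d0; set x := n%:~R / d%:~R.
have xE : numq x * d = n * denq x.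
  apply/(@intr_inj rat); rewrite !intrM numqE /x mulrAC divfK // intr_eq0 //.
by rewrite /ratr; apply/eqP; rewrite eqr_div ?pchar0_intr_eq0 ?denq_neq0 // -!intrM xE.
Qed.

Lemma pchar0_ratr_zmod_morphism : zmod_morphism (@ratr F).
Proof.
move=> x y; rewrite -{1}[x]divq_num_den -{1}[y]divq_num_den.
rewrite -mulNr -intrN addf_div ?intr_eq0 ?denq_neq0 // -!intrM -intrD.
rewrite pchar0_ratr_frac ?mulf_neq0 ?denq_neq0 // /ratr.
rewrite -mulNr -intrN addf_div ?pchar0_intr_eq0 ?denq_neq0 //.
by rewrite intrD !intrM.
Qed.

Lemma pchar0_ratr_monoid_morphism : monoid_morphism (@ratr F).
Proof.
split=> [|x y]; first exact: ratr_int 1.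
rewrite -{1}[x]divq_num_den -{1}[y]divq_num_den mulf_div -!intrM.
by rewrite pchar0_ratr_frac ?mulf_neq0 ?denq_neq0 // /ratr mulf_div -!intrM.
Qed.

End RationalEmbedding.

(** * Orders and valuations in the p-adic field *)

Section Padic.
Variables (p : nat) (pr_p : prime p).
Local Notation padic := (padic pr_p).
Local Notation "x %:F" := (@FracField.tofrac (padicint pr_p) x).
Implicit Types (u v : padic) (j k : int).

Lemma pchar_padic : [pchar padic] =i pred0.
Proof.
apply/pcharf0P => n; rewrite -(rmorph_nat (@FracField.tofrac (padicint pr_p))).
rewrite tofrac_eq0; apply/eqP/eqP => [|->//].
(* Level [n] suffices: since n < p^n, the residue of n mod p^n is n itself. *)
move=> /(congr1 (fun x : padicint pr_p => residue x n)).
by rewrite residue_nat residue0 modn_small // ltn_expl ?prime_gt1.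
Qed.

(* [ratr] is a canonical ring morphism only into a numFieldType, hence this
   copy of it. *)
Definition padic_ratr : rat -> padic := ratr.
HB.instance Definition _ := GRing.isZmodMorphism.Build rat padic padic_ratr
  (pchar0_ratr_zmod_morphism pchar_padic).
HB.instance Definition _ := GRing.isMonoidMorphism.Build rat padic padic_ratr
  (pchar0_ratr_monoid_morphism pchar_padic).

Lemma padic_order_neq0 u k : padic_order u k -> u != 0.
Proof.
case=> w uw ->; rewrite mulf_neq0 ?expfz_neq0 ?p_padic_neq0 // tofrac_eq0.
by apply: contraTneq uw => ->; rewrite unitr0.
Qed.

Lemma padic_orderM u v k j :
  padic_order u k -> padic_order v j -> padic_order (u * v) (k + j).
Proof.
move=> [w uw ->] [x ux ->]; exists (w * x); first by rewrite unitrM uw.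
by rewrite rmorphM expfzDr ?p_padic_neq0 // mulrACA.
Qed.

Lemma padic_orderV u k : padic_order u k -> padic_order u^-1 (- k).
Proof.
move=> uk; have u0 := padic_order_neq0 uk; case: uk u0 => w uw -> u0.
exists w^-1; first by rewrite unitrV.
apply: (mulfI u0); rewrite divff // mulrACA -expfzDr ?p_padic_neq0 // subrr.
by rewrite expr0z mul1r -rmorphM divrr // rmorph1.
Qed.

Lemma padic_order_val u k : padic_order u k -> (k%:E <= padic_val u)%E.
Proof. by move/padic_valE=> ->. Qed.

Lemma padic_valW u k j : j <= k -> (k%:E <= padic_val u)%E ->
  (j%:E <= padic_val u)%E.
Proof. by move=> jk; apply: le_trans; rewrite lee_fin. Qed.

Lemma padic_valM u v k j : (k%:E <= padic_val u)%E -> (j%:E <= padic_val v)%E ->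
  ((k + j)%:E <= padic_val (u * v)%R)%E.
Proof.
move=> /le_padic_val[w ->] /le_padic_val[x ->]; apply/le_padic_val.
by exists (w * x); rewrite rmorphM expfzDr ?p_padic_neq0 // mulrACA.
Qed.

(** Ultrametric equality: after factoring out p^k, a multiple of p is added to a unit, which keeps
    its nonzero residue mod p. *)
Lemma padic_order_add u v k :
  padic_order u k -> ((k + 1)%:E <= padic_val v)%E -> padic_order (u + v) k.
Proof.
move=> [w uw ->] /le_padic_val[x ->]; exists (w + p%:R * x); last first.
  by rewrite rmorphD rmorphM rmorph_nat expfzDr ?p_padic_neq0 // expr1z mulrDr mulrA.
apply/padicint_unitP; rewrite residueD residueM residue_nat expn1 modnn mul0n mod0n.
rewrite addn0 modn_small; first exact/padicint_unitP.
by have := residue_lt w 1; rewrite expn1.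
Qed.

Lemma padic_val_nexp n : (n%:Z%:E <= padic_val ((p ^ n)%:R : padic))%E.
Proof.
by apply/le_padic_val; exists 1; rewrite rmorph1 mulr1 natrX.
Qed.

Lemma padic_val_int (z : int) : (0%:E <= padic_val (z%:~R : padic))%E.
Proof.
by apply/le_padic_val; exists z%:~R; rewrite rmorph_int expr0z mul1r.
Qed.

Lemma padic_floor_val u k : padic_order u k -> k <= 0 ->
  (1%:E <= padic_val (u - ratr (padic_floor u))%R)%E.
Proof.
move=> uk k0; have vu := padic_valE uk; case: (uk) => w uw uE.
have uP := padic_digitsP u; have [_ c0 _] := uP.
(* There are m = 1 - k digit positions from k to 0, so the floor is p^k times the residue of [w] mod
   p^m, and the error is divisible by p^(k + m) = p. *)
have [m mE] : exists m : nat, k + m%:Z = 0 + 1 by exists (absz (1 - k)%R); lia.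
rewrite /padic_floor (@fsum_below _ k _ m) //; last first.
  by move=> n nk; rewrite c0 ?mul0r // vu lte_fin.
rewrite -/(padic_ratr _) rmorph_sum.
under eq_bigr => i _ do rewrite rmorphM /= fmorphXz !rmorph_nat.
rewrite partial_sum_digit_sum -(padic_expansion_residue uw uE uP).
rewrite {1}uE -mulrBr -(rmorph_nat (@FracField.tofrac (padicint pr_p)) (residue w m)) -rmorphB.
have /residue_eq0P[y ->] : residue (w - (residue w m)%:R) m = 0%N.
  have := residueD (w - (residue w m)%:R) (residue w m)%:R m.
  rewrite subrK residue_nat (modn_small (residue_lt w m)).
  rewrite -{1}(modn_small (residue_lt w m)) -{1}[residue w m]add0n => /esym/eqP.
  by rewrite eqn_modDr mod0n modn_small ?residue_lt // => /eqP.
apply/le_padic_val; exists y; rewrite rmorphM rmorphXn rmorph_nat mulrA exprnP.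
by rewrite -expfzDr ?p_padic_neq0 // mE add0r.
Qed.

End Padic.
(** One step of the algorithm multiplies the forms p_n + beta p_(n-1) and q_n + beta q_(n-1) by the
    same factor 1 / beta, so their ratio stays alpha. *)
Lemma gauss_step (F : fieldType) (beta beta' x y : F) : beta != 0 ->
  x + y * (beta^-1 - beta') + beta' * y = beta^-1 * (y + beta * x).
Proof. by move=> b0; field. Qed.

(** Over the common denominator the terms p1 q1 cancel, leaving the determinant of the convergent
    matrix times beta. *)
Lemma convergent_error (F : fieldType) (alpha beta p0 p1 q0 q1 : F) :
  q1 != 0 -> q1 + beta * q0 != 0 ->
  alpha * (q1 + beta * q0) = p1 + beta * p0 ->
  p1 / q1 - alpha =
    - ((p0 * q1 - p1 * q0) * beta) * (q1 * (q1 + beta * q0))^-1.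
Proof.
move=> q10 d0 /(canRL (mulfK d0)) ->; field.
by rewrite q10 d0.
Qed.

(** * Valuations along the algorithm and the error of the convergents *)

Section Convergence.
Variables (p : nat) (pr_p : prime p) (R : realType) (K : fieldType).
Variables (sigma_inf : {rmorphism K -> R}) (sigma_p : {rmorphism K -> padic pr_p}).
Local Notation iota_p := (@padic_ratr p pr_p).

Lemma sigma_gauss_map eps beta :
  sigma_p (gauss_map sigma_inf sigma_p eps beta) =
  (sigma_p beta)^-1 - iota_p (digit_coef sigma_inf sigma_p eps beta).
Proof. by rewrite rmorphB fmorph_rat fmorphV. Qed.

Lemma gauss_map_val eps beta k : padic_order (sigma_p beta) k -> 0 <= k ->
  ((~~ eps)%:Z%:E <=
     padic_val (sigma_p (gauss_map sigma_inf sigma_p eps beta)))%E.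
Proof.
move=> bk k0; rewrite sigma_gauss_map /digit_coef rmorphD rmorphM rmorph_int rmorph_nat.
move: (least_minimizer _) => m; rewrite opprD addrCA -fmorphV.
apply: padic_val_add; first apply: padic_val_opp.
  rewrite -[_%:Z]add0r; apply: padic_valM; first exact: padic_val_int.
  (* The integer is multiplied by 1 = p^0 or by p = p^1; this alone separates the two bounds, as the
     floor leaves valuation at least 1 in both cases. *)
  by case: eps; [exact: (padic_val_nexp _ 0)|exact: (padic_val_nexp _ 1)].
apply: (@padic_valW _ _ _ 1); first by case: eps.
by apply: (@padic_floor_val _ _ _ (- k)); rewrite ?fmorphV ?oppr_le0 //; apply: padic_orderV.
Qed.

Variable alpha : K.
Local Notation M := (convergent_mx sigma_inf sigma_p alpha).
Local Notation a_ := (partial_quotient sigma_inf sigma_p alpha).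
Local Notation alpha_ := (complete_quotient sigma_inf sigma_p alpha).

Lemma convergent_mxS n b : a_ n.+1 = Some b ->
  forall i, M n.+1 i 0 = M n i 1 /\ M n.+1 i 1 = M n i 0 + M n i 1 * b.
Proof.
move=> ab i; have e0 : ord0 = 0 :> 'I_2 by exact: val_inj.
have e1 : lift ord0 ord0 = 1 :> 'I_2 by exact: val_inj.
rewrite /convergent_mx big_nat_recr //= -mulmxE !mxE !big_ord_recl !big_ord0.
by rewrite !mxE e0 e1 ab /= !mulr0 !mulr1 !addr0 add0r.
Qed.

(* [beta] is alpha_(n+1), and the first row of the matrix holds p_(n-1), p_n,
   its second row q_(n-1), q_n; the identity matrix at [n = 0] amounts to
   p_(-1) = 1, q_(-1) = 0. *)
Definition convergent_invariant n beta (e : int) :=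
  [/\ alpha_ n.+1 = Some beta, all (fun k => a_ k != None) (iota 1 n) &
  [/\ ((~~ odd n)%:Z%:E <= padic_val (sigma_p beta))%E,
      padic_order (iota_p (M n 1 1)) e,
      ((e + (odd n)%:Z)%:E <= padic_val (iota_p (M n 1%R 0%R)))%E &
      e *+ 2 <= - n%:Z] /\
  [/\ sigma_p alpha * (iota_p (M n 1 1) + sigma_p beta * iota_p (M n 1 0)) =
        iota_p (M n 0 1) + sigma_p beta * iota_p (M n 0 0) &
      M n 0 0 * M n 1 1 - M n 0 1 * M n 1 0 = (-1) ^+ n]].

Lemma convergent_invariant0 : (0%:E < padic_val (sigma_p alpha))%E ->
  convergent_invariant 0 alpha 0.
Proof.
move=> a0; have M0 : M 0 = 1 by rewrite /convergent_mx big_geq.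
split; [by [] | by [] |]; rewrite M0 !mxE /= ?mulr0n ?mulr1n; split; split.
(* The invariant at 0 asks for valuation at least 1: orders are integers, so positivity is
   enough. *)
- have [->|/padic_order_ex[k ak]] := eqVneq (sigma_p alpha) 0.
    by rewrite /padic_val eqxx leey.
  by move: a0; rewrite (padic_valE ak) lte_fin lee_fin gtz0_ge1.
- by exists 1; rewrite ?unitr1 // [iota_p 1]rmorph1 rmorph1 mulr1.
- by rewrite [iota_p 0]rmorph0 /padic_val eqxx leey.
- by rewrite mul0rn oppr0.
- by rewrite [iota_p 0]rmorph0 [iota_p 1]rmorph1 mulr0 addr0 add0r mulr1.
- by rewrite mulr1 mul0r subr0 expr0.
Qed.

Lemma convergent_invariantS n beta e :
  convergent_invariant n beta e -> beta != 0 ->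
  exists beta' e', convergent_invariant n.+1 beta' e'.
Proof.
case=> alphan an [[vb oq vq len] [alphaE detE]] b0.
have sb0 : sigma_p beta != 0 by rewrite fmorph_eq0.
have [k bk] := padic_order_ex sb0.
have kn : (~~ odd n)%:Z <= k by move: vb; rewrite (padic_valE bk) lee_fin.
have k0 : 0 <= k by apply: le_trans kn.
set beta' := gauss_map sigma_inf sigma_p (odd n.+1) beta.
have vb' := gauss_map_val (odd n.+1) bk k0.
set b := digit_coef sigma_inf sigma_p (odd n.+1) beta.
have bE : iota_p b = (sigma_p beta)^-1 - sigma_p beta'.
  by rewrite sigma_gauss_map; ring.
(* The inverse of beta dominates: k >= 1 if n is even, and [beta'] has valuation at least 1 if n is
   odd. *)
have ob : padic_order (iota_p b) (- k).
  rewrite bE; apply: padic_order_add; first exact: padic_orderV.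
  by apply: padic_val_opp; apply: padic_valW vb'; rewrite /=; lia.
have ab : a_ n.+1 = Some b by rewrite /partial_quotient alphan (negbTE b0).
exists beta', (e - k); have MS := convergent_mxS ab.
split; last (split; split).
- by rewrite /= -/(alpha_ n.+1) alphan (negbTE b0).
- by rewrite -[n.+1]addn1 iotaD all_cat an add1n /= ab.
- exact: vb'.
(* The term a_(n+1) q_n has order e - k, and q_(n-1) has valuation at least e + [odd n], which is
   larger because k >= [~~ odd n]. *)
- rewrite (MS 1).2 rmorphD rmorphM addrC; apply: padic_order_add.
    exact: padic_orderM oq ob.
  by apply: padic_valW vq; lia.
- by rewrite (MS 1).1; apply: padic_valW (padic_order_val oq); rewrite /=; lia.
(* For n even, k >= 1 gains 2. For n odd, k may be 0, but 2e is even and at most -n, hence at most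
   -(n + 1). *)
- by lia.
- rewrite (MS 0).1 (MS 1).1 (MS 0).2 (MS 1).2 ![iota_p (_ + _)]rmorphD /=.
  rewrite ![iota_p (_ * _)]rmorphM /= bE.
  by rewrite !gauss_step // mulrCA alphaE.
- by rewrite (MS 0).1 (MS 1).1 (MS 0).2 (MS 1).2 exprS -detE; ring.
Qed.

Lemma convergent_invariant_val n beta e : convergent_invariant n beta e ->
  (n%:Z%:E <= padic_val (iota_p (M n 0 1 / M n 1 1) - sigma_p alpha)%R)%E.
Proof.
case=> _ _ [[vb oq vq len] [alphaE detE]].
set P0 := iota_p (M n 0 0) in alphaE; set P1 := iota_p (M n 0 1) in alphaE *.
set Q0 := iota_p (M n 1 0) in alphaE vq; set Q1 := iota_p (M n 1 1) in alphaE oq *.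
have {}detE : P0 * Q1 - P1 * Q0 = (-1) ^+ n.
  by rewrite -!rmorphM -rmorphB detE rmorphXn rmorphN1.
have od : padic_order (Q1 + sigma_p beta * Q0) e.
  (* The bounds [~~ odd n] and e + [odd n] add up to e + 1, so the second term is negligible. *)
  by apply: padic_order_add => //; apply: padic_valW (padic_valM vb vq); lia.
have q0 := padic_order_neq0 oq; have d0 := padic_order_neq0 od.
rewrite fmorph_div -/P1 -/Q1 (convergent_error q0 d0 alphaE) detE.
have od' := padic_order_val (padic_orderV (padic_orderM oq od)).
have vnb : (0%:E <= padic_val (- ((-1) ^+ n * sigma_p beta))%R)%E.
  apply: padic_val_opp; rewrite -signr_odd mulr_sign.
  have {}vb : (0%:E <= padic_val (sigma_p beta))%E by apply: padic_valW vb.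
  by case: odd => //; apply: padic_val_opp.
by apply: padic_valW (padic_valM vnb od'); lia.
Qed.

End Convergence.

Theorem theorem2p12 (p : nat) (pr_p : prime p) (R : realType) (K : fieldType)
    (sigma_inf : {rmorphism K -> R}) (sigma_p : {rmorphism K -> padic pr_p})
    (alpha : K) :
  property_I sigma_inf sigma_p alpha ->
  padic_limit (convergent sigma_inf sigma_p alpha) (sigma_p alpha).
Proof.
case=> _ /(convergent_invariant0 sigma_inf) inv0.
pose inv := convergent_invariant sigma_inf sigma_p alpha.
(* The invariant with beta = 0 says that alpha_(n+1) = 0, that is, the algorithm stops with p_n /
   q_n as last convergent. *)
have [[n [e invn]]|noend] := pselect (exists n e, inv n 0 e).
  right; case: (invn) => alphan an [[_ oq _ _] [alphaE _]].
  exists n, (convergent_num sigma_inf sigma_p alpha n /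
             convergent_den sigma_inf sigma_p alpha n); split.
  - by rewrite /convergent an.
  - rewrite /convergent -[n.+1]addn1 iotaD all_cat an add1n /= andbT.
    by rewrite /partial_quotient alphan eqxx.
  - rewrite -[ratr _]/(padic_ratr pr_p _) fmorph_div /=.
    apply: (mulIf (padic_order_neq0 oq)); rewrite divfK ?(padic_order_neq0 oq) //.
    (* At beta = 0 the linear relation becomes alpha q_n = p_n, so the last convergent is exactly
       alpha. *)
    by move: alphaE; rewrite rmorph0 !mul0r !addr0.
left; have invn n : exists beta e, inv n beta e.
  elim: n => [|n [beta [e invn]]]; first by exists alpha, 0.
  apply: convergent_invariantS (invn) _.
  by apply: contra_notN noend => /eqP b0; exists n, e; rewrite -b0.
exists (fun n => convergent_num sigma_inf sigma_p alpha n /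
                 convergent_den sigma_inf sigma_p alpha n) => [n|N].
  by have [beta [e [_ an _]]] := invn n; rewrite /convergent an.
(* The n-th error has valuation at least n, hence at least N once n >= |N|. *)
exists `|N|%N => n Nn; have [beta [e /convergent_invariant_val]] := invn n.
by apply: padic_valW; lia.
Qed.
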